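(* Let $n\ge 2$ and let $\lambda\in\mathbb{R}^n$ satisfy $\lambda_1\ge\lambda_2\ge\dots\ge\lambda_n$ and $\lambda_i-\lambda_j\in\mathbb{Z}$ for all $i,j$. Suppose that $$\lambda=(\underbrace{\lambda_1,\dots,\lambda_1}_{p},\lambda_{p+1},\dots,\lambda_n)$$ for some $p\in[2,n]$, with $\lambda_1>\lambda_{p+1}$ if $p<n$. Then: (1) If for some integer $i\in[1,[\frac p2]]$ $$\lambda_1<-n+p-i+1,$$ then $$\|(\lambda-s)^++\rho\|^2>\|\lambda+\rho\|^2$$ for every Schmid module $s$ with at most $2i$ nonzero components. (2) If $$\lambda_1<-n+p-\left[\frac p2\right]+1=-n+\left[\frac{p+1}{2}\right]+1,$$ then $\|(\lambda-s)^++\rho\|^2>\|\lambda+\rho\|^2$ for every Schmid module $s$.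
   Context: This is the case $\mathfrak{g}_0=\mathfrak{so}^*(2n)$. Here $\rho=(n-1,n-2,\dots,1,0)$ and $\|\cdot\|$ is the standard Euclidean norm on $\mathbb{R}^n$. The Weyl group $W_{\mathfrak{k}}$ acts on $\mathbb{R}^n$ by all permutations of the coordinates, and for $\mu\in\mathbb{R}^n$, $\mu^+$ denotes the unique $W_{\mathfrak{k}}$-conjugate of $\mu$ with coordinates in weakly decreasing order. A Schmid module is identified with an $n$-tuple $s=(b_1,b_1,b_2,b_2,\dots,b_j,b_j,0,\dots,0)$ for some $j$ with $1\le j\le[n/2]$ and some positive integers $b_1\ge b_2\ge\dots\ge b_j$. $[x]$ denotes the integer part of $x$. *)

(* Defs.v *)
From HB Require Import structures.
From mathcomp Require Import all_boot all_order all_fingroup all_algebra.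
From mathcomp Require Import reals.
Set Implicit Arguments.
Unset Strict Implicit.
Unset Printing Implicit Defensive.
Import Order.TTheory GRing.Theory Num.Theory.
Local Open Scope ring_scope.

(* Vectors of R^n are row vectors 'rV[R]_n; coordinates are indexed from 0,
   so that the k-th coordinate of the usual notation has index k - 1. *)

Definition decreasing (R : realType) (n : nat) (mu : 'rV[R]_n) : Prop :=
  forall i j : 'I_n, (i <= j)%N -> mu 0 j <= mu 0 i.

(* The matrix norm of MathComp-Analysis is the sup norm. *)
Definition enorm (R : realType) (n : nat) (mu : 'rV[R]_n) : R :=
  Num.sqrt (\sum_(i < n) mu 0 i ^+ 2).

(* (n-1, n-2, ..., 1, 0); the natural subtraction is exact as i < n. *)
Definition rho (R : realType) (n : nat) : 'rV[R]_n :=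
  \row_(i < n) (n - i.+1)%:R.

(* The weakly decreasing rearrangement mu^+ of mu; see [dominantP] and
   [dominant_uniq]. *)
Definition dominant (R : realType) (n : nat) (mu : 'rV[R]_n) : 'rV[R]_n :=
  \row_(i < n) nth 0 (sort >=%R [seq mu 0 k | k <- enum 'I_n]) i.

(* s = (b_1, b_1, b_2, b_2, ..., b_j, b_j, 0, ..., 0), where j = size b. *)
Definition schmid (R : realType) (n : nat) (s : 'rV[R]_n) : Prop :=
  exists b : seq nat,
    [/\ (1 <= size b <= n./2)%N, all (leq 1) b, sorted geq b &
        s = \row_(i < n) (nth 0%N b i./2)%:R].

Definition nb_nonzero (R : realType) (n : nat) (s : 'rV[R]_n) : nat :=
  #|[set i : 'I_n | s 0 i != 0]|.

Lemma dominantP (R : realType) (n : nat) (mu : 'rV[R]_n) :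
  decreasing (dominant mu) /\ exists w : 'S_n, dominant mu = col_perm w mu.
Proof.
set m := [seq mu 0 k | k <- enum 'I_n].
have szm : size m = n by rewrite size_map size_enum_ord.
have szs : size (sort >=%R m) = n by rewrite size_sort.
split.
  move=> i j le_ij; rewrite !mxE.
  have srt : sorted >=%R (sort >=%R m).
    by apply: sort_sorted => x y; rewrite real_leVge ?num_real.
  have tr : transitive (>=%R : rel R).
    by move=> y x z /= le_yx le_zy; apply: le_trans le_zy le_yx.
  by apply: (sorted_leq_nth tr (@lexx _ R) 0 srt); rewrite ?inE ?szs.
pose t : n.-tuple R := [tuple mu 0 k | k < n].
have tm : tval t = m by [].
pose u : n.-tuple R := Tuple (introT eqP szs).
have /tuple_permP [w Ew] : perm_eq u t by rewrite tm perm_sort.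
exists w; apply/rowP => i; rewrite !mxE -/m.
have -> : sort >=%R m = tval u by [].
by rewrite Ew -tnth_nth !tnth_mktuple.
Qed.

Lemma dominant_uniq (R : realType) (n : nat) (mu nu : 'rV[R]_n) (w : 'S_n) :
  nu = col_perm w mu -> decreasing nu -> nu = dominant mu.
Proof.
have perm_coords (a : 'rV[R]_n) (v : 'S_n) :
  perm_eq [seq col_perm v a 0 k | k <- enum 'I_n] [seq a 0 k | k <- enum 'I_n].
  apply/(@tuple_permP _ n _ [tuple a 0 k | k < n]).
  exists v; apply: eq_map => k /=.
  by rewrite mxE tnth_mktuple.
move=> Enu dec_nu.
have srt : sorted >=%R [seq nu 0 k | k <- enum 'I_n].
  apply: (homo_sorted (e := fun i j : 'I_n => (i <= j)%N)) => [i j|].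
    exact: dec_nu.
  have := iota_sorted 0 n.
  by rewrite -val_enum_ord sorted_map.
have E : [seq nu 0 k | k <- enum 'I_n] = sort >=%R [seq mu 0 k | k <- enum 'I_n].
  apply: (@sorted_eq _ >=%R) => //.
  - by move=> y x z /= le_yx le_zy; apply: le_trans le_zy le_yx.
  - by move=> x y /= /andP[le_yx le_xy]; apply/le_anti/andP.
  - by apply: sort_sorted => x y; rewrite real_leVge ?num_real.
  - by rewrite perm_sym perm_sort perm_sym Enu perm_coords.
apply/rowP => i; rewrite mxE -E (nth_map i) ?size_enum_ord //.
by rewrite nth_ord_enum.
Qed.

(* Main.v *)
Require Import Defs.
From HB Require Import structures.
From mathcomp Require Import all_boot all_order all_fingroup all_algebra.
From mathcomp Require Import reals.
From mathcomp Require Import zify ring lra.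
Set Implicit Arguments.
Unset Strict Implicit.
Unset Printing Implicit Defensive.
Import Order.TTheory GRing.Theory Num.Theory.
Local Open Scope ring_scope.

(** Write [f = lambda + w rho], where the permutation [w] reverses the first
[p] coordinates.  Since [lambda] is constant there, [w lambda = lambda].  The
rearrangement inequality bounds the pairing of the dominant vector
[(lambda - s)^+] with [rho] from below by that of [lambda - s] with [w rho];
expanding the squares and using [<lambda, w rho> = <lambda, rho>] gives

  [||(lambda - s)^+ + rho||^2 - ||lambda + rho||^2 >= ||s||^2 - 2 <s, f>]

([norm_gap]).  Among the permutations of the block, [w] puts the small entries
of [rho] on the coordinates where [s] is large.

Grouping coordinates in pairs, with [c_k = f_(2k) + f_(2k+1)], the right-hand
side is [2 sum_k b_k (b_k - c_k)], which is at least
[2 sum_k b_k (1 - c_k)] because the [b_k] are positive integers.  As [b]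
is nonincreasing, summation by parts ([abel_lower_bound]) makes this positive
as soon as [c_0 + ... + c_(k-1) < k] for all [1 <= k <= size b]
([sum_pairs_gt0]).

It remains to bound these partial sums ([schmid_gap]).  While [2k <= p], the
partial sum is [k (2 (lambda_1 + n - p) + 2k - 1)], and the bound on
[lambda_1] makes it smaller than [k (2k + 1 - 2i) <= k], as [k <= i].  If
[2k > p], which only happens for [i = p./2], the bound propagates from [k - 1]
to [k], since then [c_(k-1) < 1]: on the coordinates past [p], [f] is already
nonpositive, and a pair straddling [p] is checked directly. *)

(** * Summation by parts and rearrangement *)

(** Summation by parts, run as an induction: lowering the weight of an already
nonnegative partial sum from [b n] to [b n.+1] can only decrease the product. *)
Lemma abel_lower_bound (R : realDomainType) (b g : nat -> R) (n : nat) :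
    (forall k, (k < n)%N -> b k.+1 <= b k) ->
    (forall k, (k < n)%N -> 0 <= \sum_(l < k.+1) g l) ->
  b n * \sum_(l < n.+1) g l <= \sum_(l < n.+1) b l * g l.
Proof.
elim: n => [|n IHn] bdec g_ge0; first by rewrite !big_ord1.
rewrite big_ord_recr [leRHS]big_ord_recr /= mulrDr lerD2r.
apply: le_trans (IHn _ _); first by rewrite ler_wpM2r ?g_ge0 ?bdec.
- by move=> k ltkn; apply/bdec/ltnW.
- by move=> k ltkn; apply/g_ge0/ltnW.
Qed.

(** Both sides have [k] terms, so [r k] may be subtracted from each of them.
The terms of [r - r k] are nonnegative before index [k] and nonpositive from
[k] on, so no other choice of [k] indices does better than the first [k]. *)
Lemma sum_initial_max (R : realDomainType) (n : nat) (r : 'I_n -> R)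
    (sigma : 'S_n) (k : 'I_n) :
    (forall i j : 'I_n, (i <= j)%N -> r j <= r i) ->
  \sum_(i < n | (i < k)%N) r (sigma i) <= \sum_(i < n | (i < k)%N) r i.
Proof.
move=> rdec.
have shift (h : 'I_n -> 'I_n) : \sum_(i < n | (i < k)%N) r (h i) =
    \sum_(i < n | (i < k)%N) (r (h i) - r k) + \sum_(i < n | (i < k)%N) r k.
  by rewrite -big_split /=; apply: eq_bigr => i _; rewrite subrK.
rewrite (shift sigma) (shift id) lerD2r.
(* The left sum now runs over the image under sigma of the first k indices. *)
rewrite (reindex_inj (@perm_inj _ (sigma^-1)%g)) /=.
under eq_bigr do rewrite permKV.
rewrite big_mkcond [leRHS]big_mkcond /=; apply: ler_sum => i _.
case: (ltnP i k) => [ltik|leki].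
  by case: ifP => // _; rewrite subr_ge0 rdec // ltnW.
by case: ifP => // _; rewrite subr_le0 rdec.
Qed.

(** Summation by parts against [g i = r i - r (sigma i)]: its partial sums are
nonnegative by [sum_initial_max] and its total vanishes. *)
Lemma rearrangement (R : realDomainType) (n : nat) (v r : 'I_n -> R)
    (sigma : 'S_n) :
    (forall i j : 'I_n, (i <= j)%N -> v j <= v i) ->
    (forall i j : 'I_n, (i <= j)%N -> r j <= r i) ->
  \sum_(i < n) v i * r (sigma i) <= \sum_(i < n) v i * r i.
Proof.
case: n v r sigma => [|n] v r sigma vdec rdec; first by rewrite !big_ord0.
pose g i := r i - r (sigma i).
have sum_g0 : \sum_i g i = 0.
  by rewrite sumrB [X in X - _](reindex_inj (@perm_inj _ sigma)) subrr.
suff : 0 <= \sum_i v i * g i.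
  by under eq_bigr do rewrite mulrBr; rewrite sumrB subr_ge0.
have := @abel_lower_bound R (fun l => v (inord l)) (fun l => g (inord l)) n.
under [X in _ * X <= _]eq_bigr do rewrite inord_val.
under [X in _ <= X]eq_bigr do rewrite inord_val.
rewrite sum_g0 mulr0; apply=> k ltkn.
  by rewrite vdec // !inordK // ltnW.
have -> : \sum_(l < k.+1) g (inord l) = \sum_(i < n.+1 | (i < k.+1)%N) g i.
  rewrite (big_ord_widen n.+1 (fun l => g (inord l))) 1?ltnW //.
  by apply: eq_bigr => i _; rewrite inord_val.
rewrite sumrB subr_ge0.
have := @sum_initial_max R n.+1 r sigma (inord k.+1) rdec.
by rewrite inordK.
Qed.

(** * Norms of dominant vectors *)

Lemma enorm_sqr (R : realType) (n : nat) (mu : 'rV[R]_n) :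
  enorm mu ^+ 2 = \sum_(i < n) mu 0 i ^+ 2.
Proof. by rewrite sqr_sqrtr // sumr_ge0 // => i _; apply: sqr_ge0. Qed.

Lemma rho_decreasing (R : realType) (n : nat) : decreasing (rho R n).
Proof. by move=> i j le_ij; rewrite !mxE ler_nat leq_sub2l. Qed.

(** If the dominant vector is [col_perm v (lambda - s)], rearrangement along
[v * w] compares its pairing with [rho] to the pairing of [lambda - s] with
[w rho]; the terms in [lambda] alone cancel as [w] fixes [lambda]. *)
Lemma norm_gap (R : realType) (n : nat) (lambda s : 'rV[R]_n) (w : 'S_n) :
    (forall i, lambda 0 (w i) = lambda 0 i) ->
  enorm (lambda + rho R n) ^+ 2 +
      \sum_(i < n) s 0 i * (s 0 i - (lambda 0 i + rho R n 0 (w i)) *+ 2)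
    <= enorm (dominant (lambda - s) + rho R n) ^+ 2.
Proof.
move=> lambda_w; rewrite !enorm_sqr.
have [mu_dec [v mu_v]] := dominantP (lambda - s).
have muE i : dominant (lambda - s) 0 i = lambda 0 (v i) - s 0 (v i).
  by rewrite mu_v !mxE.
have le_rho := @rearrangement R n (fun i => dominant (lambda - s) 0 i)
  (fun i => rho R n 0 i) (v * w)%g mu_dec (@rho_decreasing R n).
have sqrDE (a : 'I_n -> R) :
    \sum_i (a i + rho R n 0 i) ^+ 2 =
    \sum_i a i ^+ 2 + (\sum_i a i * rho R n 0 i) *+ 2 + \sum_i rho R n 0 i ^+ 2.
  rewrite -sumrMnl -!big_split /=; apply: eq_bigr => i _.
  by rewrite sqrrD.
under eq_bigr do rewrite mxE.
under [leRHS]eq_bigr do rewrite mxE.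
rewrite !sqrDE.
have mu_sqr : \sum_i dominant (lambda - s) 0 i ^+ 2 =
    \sum_i (lambda 0 i - s 0 i) ^+ 2.
  rewrite [RHS](reindex_inj (@perm_inj _ v)).
  by apply: eq_bigr => i _; rewrite muE.
have mu_rho : \sum_i dominant (lambda - s) 0 i * rho R n 0 ((v * w)%g i) =
    \sum_i (lambda 0 i - s 0 i) * rho R n 0 (w i).
  rewrite [RHS](reindex_inj (@perm_inj _ v)).
  by apply: eq_bigr => i _; rewrite muE permM.
have lambda_rho : \sum_i lambda 0 i * rho R n 0 i =
    \sum_i lambda 0 i * rho R n 0 (w i).
  rewrite (reindex_inj (@perm_inj _ w)).
  by apply: eq_bigr => i _; rewrite lambda_w.
rewrite mu_sqr lambda_rho.
rewrite mu_rho in le_rho.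
suff : \sum_i lambda 0 i ^+ 2 + (\sum_i lambda 0 i * rho R n 0 (w i)) *+ 2
    + \sum_i s 0 i * (s 0 i - (lambda 0 i + rho R n 0 (w i)) *+ 2)
  = \sum_i (lambda 0 i - s 0 i) ^+ 2
    + (\sum_i (lambda 0 i - s 0 i) * rho R n 0 (w i)) *+ 2 by lra.
rewrite -!sumrMnl -!big_split /=; apply: eq_bigr => i _.
ring.
Qed.

(** * Sums over the pairs of a Schmid module *)

Lemma sum_pairs (R : nmodType) (F : nat -> R) (n j : nat) :
    (j.*2 <= n)%N -> (forall m, (j.*2 <= m)%N -> F m = 0) ->
  \sum_(m < n) F m = \sum_(k < j) (F k.*2 + F k.*2.+1).
Proof.
move=> le_jn F0.
rewrite -(big_mkord xpredT F) (big_cat_nat (n := j.*2)) //=.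
rewrite [X in _ + X]big_nat_cond [X in _ + X]big1 => [|m]; last first.
  by rewrite andbT => /andP[/F0].
rewrite addr0; elim: j {le_jn F0} => [|j IHj]; first by rewrite big_geq ?big_ord0.
by rewrite doubleS !big_nat_recr //= IHj big_ord_recr /= addrA.
Qed.

(** Replacing [b_k - c_k] by [1 - c_k] only lowers the sum, as
[b_k >= 1], and leaves a sequence whose partial sums are positive by
assumption, to which summation by parts against [b] applies. *)
Lemma sum_pairs_gt0 (R : realDomainType) (b : seq nat) (c : nat -> R) :
    (0 < size b)%N -> sorted geq b -> all (leq 1) b ->
    (forall k, (0 < k <= size b)%N -> \sum_(l < k) c l < k%:R) ->
  0 < \sum_(k < size b) (nth 0%N b k)%:R * ((nth 0%N b k)%:R - c k).
Proof.
move=> b0 bdec b_ge1 sum_c.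
have sum1c k : \sum_(l < k) (1 - c l) = k%:R - \sum_(l < k) c l.
  by rewrite sumrB sumr_const card_ord.
case sz: (size b) b0 => [//|j] _.
have lt_sz k : (k <= j)%N -> (k < size b)%N by rewrite sz.
have nth_ge1 k : (k <= j)%N -> (1 <= nth 0%N b k)%N.
  by move=> /lt_sz; apply/all_nthP.
have geq_trans : transitive geq by move=> y x z /= h1 h2; apply: leq_trans h1.
apply: (@lt_le_trans _ _ (\sum_(k < j.+1) (nth 0%N b k)%:R * (1 - c k))).
  apply: lt_le_trans (abel_lower_bound (b := fun k => (nth 0%N b k)%:R)
    (g := fun k => 1 - c k) _ _).
  - rewrite mulr_gt0 ?ltr0n ?nth_ge1 // sum1c subr_gt0 sum_c //.
    by rewrite sz leqnn.
  - move=> k ltkj; rewrite ler_nat.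
    apply: (sorted_leq_nth geq_trans leqnn 0%N bdec) => //; rewrite inE sz //.
    by rewrite ltnS ltnW.
  - move=> k ltkj; rewrite sum1c subr_ge0 ltW // sum_c //.
    by rewrite sz /= ltnW.
apply: ler_sum => k _.
have h1 : 1 <= (nth 0%N b k)%:R :> R by rewrite ler1n nth_ge1 // -ltnS.
by rewrite ler_wpM2l ?lerD2r // ler0n.
Qed.

(** * Reversal of the constant block, and the main estimate *)

(** The bound [p <= n] in the test keeps the values of [m < n] below [n]
whatever [p] is. *)
Definition rev_first (p n m : nat) : nat :=
  if (m < p <= n)%N then (p.-1 - m)%N else m.

Lemma rev_first_lt (p n : nat) (i : 'I_n) : (rev_first p n i < n)%N.
Proof. by rewrite /rev_first; have := ltn_ord i; case: ifP; lia. Qed.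

Definition rev_first_ord (p n : nat) (i : 'I_n) : 'I_n :=
  Ordinal (rev_first_lt p i).

Lemma rev_first_ord_inj (p n : nat) : injective (@rev_first_ord p n).
Proof.
by move=> i j [] eq_ij; apply/val_inj => /=; move: eq_ij; rewrite /rev_first;
   case: ifP; case: ifP; lia.
Qed.

(** Common form of both parts of the theorem: either [s] has at most [i] pairs,
or [i] is the largest value allowed and [s] is arbitrary.  The second case
differs only in the pairs meeting coordinates past the constant block. *)
Lemma schmid_gap (R : realType) (n p i : nat) (lambda s : 'rV[R]_n)
    (lambda1 : R) (b : seq nat) :
    (p <= n)%N -> (i <= p./2)%N ->
    (forall m : 'I_n, (m < p)%N -> lambda 0 m = lambda1) ->
    (forall m : 'I_n, lambda 0 m <= lambda1) ->
    lambda1 < - n%:R + p%:R - i%:R + 1 ->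
    (0 < size b <= n./2)%N -> all (leq 1) b -> sorted geq b ->
    s = \row_(m < n) (nth 0%N b m./2)%:R ->
    (size b <= i)%N \/ i = p./2 ->
  enorm (lambda + rho R n) ^+ 2
    < enorm (dominant (lambda - s) + rho R n) ^+ 2.
Proof.
move=> le_pn le_ip lambda_p lambda_le lt_lambda1 /andP[b_gt0 le_bn] b_ge1 b_dec
  def_s size_or.
have n_gt0 : (0 < n)%N by lia.
case: n n_gt0 => // n _ in lambda s le_pn lambda_p lambda_le lt_lambda1 le_bn def_s *.
pose w : 'S_n.+1 := perm (@rev_first_ord_inj p n.+1).
have val_w m : (w m : nat) = rev_first p n.+1 m by rewrite permE.
have lambda_w m : lambda 0 (w m) = lambda 0 m.
  have [lt_mp|le_pm] := ltnP m p; last first.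
    by congr (lambda _ _); apply/val_inj; rewrite /= val_w /rev_first ltnNge le_pm.
  by rewrite !lambda_p // val_w /rev_first lt_mp le_pn /=; lia.
apply: lt_le_trans (norm_gap s lambda_w); rewrite ltrDl.
pose f m := lambda 0 (inord m) + rho R n.+1 0 (w (inord m)).
pose F m := (nth 0%N b m./2)%:R * ((nth 0%N b m./2)%:R - f m *+ 2).
have -> : \sum_i s 0 i * (s 0 i - (lambda 0 i + rho R n.+1 0 (w i)) *+ 2)
    = \sum_(m < n.+1) F m.
  by apply: eq_bigr => m _; rewrite def_s /F /f inord_val mxE.
rewrite (@sum_pairs _ F n.+1 (size b)) => [|| m le_bm]; first last.
- by rewrite /F nth_default ?mul0r //; lia.
- by lia.
pose c k := f k.*2 + f k.*2.+1.
have -> : \sum_(k < size b) (F k.*2 + F k.*2.+1) =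
    (\sum_(k < size b) (nth 0%N b k)%:R * ((nth 0%N b k)%:R - c k)) *+ 2.
  rewrite -sumrMnl; apply: eq_bigr => k _.
  by rewrite /F (half_bit_double k true) doubleK /c; ring.
rewrite pmulrn_lgt0 //; apply: sum_pairs_gt0 => //.
(* The reversed rho grows along the block, from n - p up to n - 1. *)
have f_head m : (m < p)%N -> f m = lambda1 + (n.+1%:R - p%:R) + m%:R.
  move=> lt_mp; have lt_mn : (m < n.+1)%N by lia.
  rewrite /f lambda_p ?inordK // mxE val_w inordK // /rev_first lt_mp le_pn /=.
  rewrite -addrA -natrB // -natrD; congr (_ + _%:R); lia.
have f_tail m : (p <= m < n.+1)%N -> f m <= lambda1 + n.+1%:R - m.+1%:R.
  move=> /andP[le_pm lt_mn].
  rewrite /f mxE val_w inordK // /rev_first ltnNge le_pm /=.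
  by rewrite natrB // addrA lerD2r lerD2r.
elim=> [//|k IHk] /andP[_ lt_kb]; rewrite big_ord_recr /=.
(* Pairs inside the block are summed in closed form; once a pair leaves it,
   the bound for the previous pairs is extended by c k < 1. *)
have [le_kp|lt_pk] := leqP k.+1.*2 p.
  have le_ki : (k < i)%N by lia.
  have -> : \sum_(l < k) c l =
      k%:R * ((lambda1 + (n.+1%:R - p%:R)) *+ 2 + k.*2%:R - 1).
    have : (k.*2 <= p)%N by lia.
    elim: (k) => [|l IHl] le_lp; first by rewrite big_ord0 mul0r.
    rewrite big_ord_recr /= IHl ?/c; last by lia.
    rewrite !f_head; try lia.
    rewrite -!muln2 !natrM -!natr1 !natrM; ring.
  rewrite /c !f_head; try lia.
  have le_kiR : k.+1%:R <= i%:R :> R by rewrite ler_nat.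
  have k_ge0 : 0 <= k%:R :> R by rewrite ler0n.
  rewrite -!muln2 -!natr1 !natrM in le_kiR lt_lambda1 *.
  nra.
have def_i : i = p./2 by case: size_or; lia.
have c_lt1 : c k < 1.
  have [le_pk|lt_kp] := leqP p k.*2.
    have f0 := f_tail k.*2 ltac:(lia).
    have f1 := f_tail k.*2.+1 ltac:(lia).
    have le_R : p%:R + 1 <= i%:R + k.*2.+1%:R :> R.
      by rewrite -natrD natr1 ler_nat; lia.
    rewrite /c; rewrite -!natr1 in f0 f1 le_R lt_lambda1; lra.
  (* The pair straddles the end of the block: its first coordinate has the
     largest value n - 1 of the reversed rho, its second one is past p. *)
  have p_odd : p = k.*2.+1 by lia.
  have i_k : i = k by lia.
  have f1 := f_tail k.*2.+1 ltac:(lia).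
  rewrite /c f_head //; rewrite i_k p_odd -muln2 -!natr1 natrM in f1 lt_lambda1 *.
  lra.
rewrite -natr1; apply: ler_ltD c_lt1.
case: k IHk lt_kb {lt_pk} => [_ _|k IHk lt_kb]; first by rewrite big_ord0.
by apply/ltW/IHk; rewrite /= ltnW.
Qed.

Lemma size_schmid (R : realType) (n : nat) (s : 'rV[R]_n) (b : seq nat) :
    (size b <= n./2)%N -> all (leq 1) b ->
    s = \row_(i < n) (nth 0%N b i./2)%:R ->
  (2 * size b <= nb_nonzero s)%N.
Proof.
move=> le_bn b_ge1 ->.
have le_n : (2 * size b <= n)%N by lia.
(* The first 2 * size b coordinates are all nonzero. *)
rewrite -[X in (X <= _)%N]card_ord.
rewrite -(card_codom (f := widen_ord le_n)); last first.
  by move=> x y /(congr1 val) /= /val_inj.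
apply/subset_leq_card/subsetP => _ /codomP[x ->]; rewrite inE mxE /= pnatr_eq0.
rewrite -lt0n; apply: (all_nthP 0%N b_ge1); have := ltn_ord x; lia.
Qed.

Theorem theorem3p31 (R : realType) (n : nat) (hn : (2 <= n)%N)
    (lambda : 'rV[R]_n)
    (hdec : decreasing lambda)
    (hint : forall i j : 'I_n, lambda 0 i - lambda 0 j \is a Num.int)
    (lambda1 : R) (hlambda1 : lambda1 = lambda 0 (Ordinal (ltnW hn)))
    (p : nat) (hp : (2 <= p <= n)%N)
    (hconst : forall i : 'I_n, (i < p)%N -> lambda 0 i = lambda1)
    (hdrop : forall hpn : (p < n)%N, lambda 0 (Ordinal hpn) < lambda1) :
  (forall i : nat, (1 <= i <= p./2)%N ->
     lambda1 < - n%:R + p%:R - i%:R + 1 ->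
     forall s : 'rV[R]_n, schmid s -> (nb_nonzero s <= 2 * i)%N ->
       enorm (lambda + rho R n) ^+ 2
         < enorm (dominant (lambda - s) + rho R n) ^+ 2)
  /\
  (- n%:R + p%:R - (p./2)%:R + 1 = - n%:R + (p.+1./2)%:R + 1 :> R
   /\
   (lambda1 < - n%:R + p%:R - (p./2)%:R + 1 ->
     forall s : 'rV[R]_n, schmid s ->
       enorm (lambda + rho R n) ^+ 2
         < enorm (dominant (lambda - s) + rho R n) ^+ 2)).
Proof.
have lambda_le m : lambda 0 m <= lambda1 by rewrite hlambda1 hdec.
move: hp => /andP[_ le_pn].
split; [|split].
- move=> i /andP[_ le_ip] lt_lambda1 s [b [size_b b_ge1 b_dec def_s]] nb_s.
  apply: (schmid_gap le_pn le_ip hconst lambda_le lt_lambda1 size_b b_ge1 b_dec def_s).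
  left; case/andP: size_b => _ le_bn.
  by have := size_schmid le_bn b_ge1 def_s; lia.
- have def_p : p%:R = (p./2)%:R + (p.+1./2)%:R :> R.
    by rewrite -natrD; congr _%:R; lia.
  by rewrite [X in - n%:R + X]def_p; ring.
- move=> lt_lambda1 s [b [size_b b_ge1 b_dec def_s]].
  apply: (schmid_gap le_pn (leqnn _) hconst lambda_le lt_lambda1 size_b b_ge1 b_dec def_s).
  by right.
Qed.
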